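(* Let $m\ge1$, $D\subset\mathbb{R}^m$ compact, let $\phi:D\to D$ be a Lipschitz continuous map with Lipschitz constant $L_\phi$, and let $S:[0,1]^m\to D$ be a Lipschitz continuous bijective map with Lipschitz constant $L_S$ and partial Lipschitz constants $L_S^{(l)}$, $l=1,\dots,m$. Let $\mathcal{K}f=f\circ\phi$ be the Koopman operator on $C(D)$ and let $\mathbf{n}=(n_1,\dots,n_m)$ have positive integer entries. Then, for $f\in C(D)$, $$\|\tilde{\mathcal{B}}_\mathbf{n}\mathcal{K}f-\mathcal{K}f\|_\infty\leq\frac{3}{2}\,\Omega_f\left(L_{\phi}L_S\sqrt{\sum_{l=1}^m\frac{1}{n_l}}\right)$$ and $$\|\tilde{\mathcal{B}}_\mathbf{n}\mathcal{K}f-\mathcal{K}f\|_\infty\leq\frac{3}{2}\sum_{l=1}^m\Omega_f\left(\frac{L_\phi L_S^{(l)}}{\sqrt{n_l}}\right).$$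
   Context: $C(D)$ is the space of continuous complex-valued functions on $D$, with $\|f\|_\infty=\sup_{\mathbf{x}\in D}|f(\mathbf{x})|$; $\|\cdot\|$ is the Euclidean norm on $\mathbb{R}^m$. The Bernstein operator on $C([0,1]^m)$ is $$\mathcal{B}_\mathbf{n}(g;\mathbf{x})=\sum_{k_1=0}^{n_1}\cdots\sum_{k_m=0}^{n_m} g\left(\tfrac{k_1}{n_1},\dots,\tfrac{k_m}{n_m}\right)\prod_{l=1}^m b_{n_l,k_l}(x_l),\qquad b_{n,k}(x)=\binom{n}{k}x^k(1-x)^{n-k}.$$ The modified Bernstein operator $\tilde{\mathcal{B}}_\mathbf{n}:C(D)\to C(D)$ associated with a continuous bijection $S:[0,1]^m\to D$ is $(\tilde{\mathcal{B}}_\mathbf{n}f)(\mathbf{x})=\mathcal{B}_\mathbf{n}(f\circ S;S^{-1}(\mathbf{x}))$. A Lipschitz constant of a map $g$ is any real $L_g\ge0$ with $\|g(\mathbf{x})-g(\mathbf{y})\|\le L_g\|\mathbf{x}-\mathbf{y}\|$ for all $\mathbf{x},\mathbf{y}$ in its domain. A partial Lipschitz constant $L_S^{(l)}\ge0$ is a real number such that $\|S(\mathbf{x})-S(\mathbf{y})\|\le L_S^{(l)}|x_l-y_l|$ for all $\mathbf{x},\mathbf{y}\in[0,1]^m$ that differ only in their $l$th coordinate. For $f\in C(D)$ and $\delta\ge0$, $\Omega_f(\delta)=\sup\{|f(\mathbf{x})-f(\mathbf{y})|:\mathbf{x},\mathbf{y}\in D,\ \|\mathbf{x}-\mathbf{y}\|\le\delta\}$.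 *)

(* Defs.v *)
From HB Require Import structures.
From mathcomp Require Import all_boot all_order all_algebra.
From mathcomp Require Import complex.
From mathcomp Require Import all_classical all_reals all_analysis.

Set Implicit Arguments.
Unset Strict Implicit.
Unset Printing Implicit Defensive.

Import Order.TTheory GRing.Theory Num.Theory.
Import numFieldNormedType.Exports.

Local Open Scope classical_set_scope.
Local Open Scope complex_scope.
Local Open Scope ring_scope.

(* The library norm on 'rV[R]_m is the max norm, hence this separate
   definition; both induce the library topology on 'rV[R]_m. *)
Definition euclid_norm (R : realType) (m : nat) (x : 'rV[R]_m) : R :=
  Num.sqrt (\sum_(l < m) x 0 l ^+ 2).

Definition unit_cube (R : realType) (m : nat) : set 'rV[R]_m :=
  [set x | forall l, 0 <= x 0 l <= 1].
Arguments unit_cube R m : clear implicits.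

Definition lipschitz_constant (R : realType) (m : nat) (A : set 'rV[R]_m)
    (g : 'rV[R]_m -> 'rV[R]_m) (L : R) : Prop :=
  0 <= L /\
  forall x y, A x -> A y ->
    euclid_norm (g x - g y) <= L * euclid_norm (x - y).

Definition partial_lipschitz_constant (R : realType) (m : nat)
    (S : 'rV[R]_m -> 'rV[R]_m) (l : 'I_m) (L : R) : Prop :=
  0 <= L /\
  forall x y, unit_cube R m x -> unit_cube R m y ->
    (forall j, j != l -> x 0 j = y 0 j) ->
    euclid_norm (S x - S y) <= L * `|x 0 l - y 0 l|.

(* Complex-valued functions on D are total functions of which only the values
   on D matter.  The codomain R[i]^o is the complex numbers with the topology
   of the modulus. *)
Definition continuous_on (R : realType) (m : nat) (D : set 'rV[R]_m)
    (f : 'rV[R]_m -> R[i]) : Prop :=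
  {within D, continuous (f : 'rV[R]_m -> R[i]^o)}.

(* Suprema are taken in \bar R, so that no default value is involved; normc is
   the R-valued modulus. *)
Definition sup_norm (R : realType) (m : nat) (D : set 'rV[R]_m)
    (f : 'rV[R]_m -> R[i]) : \bar R :=
  ereal_sup [set (Normc.normc (f x))%:E | x in D].

Definition modulus_of_continuity (R : realType) (m : nat) (D : set 'rV[R]_m)
    (f : 'rV[R]_m -> R[i]) (delta : R) : \bar R :=
  ereal_sup [set r | exists x y, [/\ D x, D y, euclid_norm (x - y) <= delta
                                   & r = (Normc.normc (f x - f y))%:E]].

Definition bernstein_basis (R : realType) (n k : nat) (x : R) : R :=
  'C(n, k)%:R * x ^+ k * (1 - x) ^+ (n - k).

(* The iterated sum over 0 <= k_l <= n_l is a single sum over multi-indices. *)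
Definition bernstein (R : realType) (m : nat) (n : 'I_m -> nat)
    (g : 'rV[R]_m -> R[i]) (x : 'rV[R]_m) : R[i] :=
  \sum_(k : {dffun forall l : 'I_m, 'I_(n l).+1})
    g (\row_l ((k l)%:R / (n l)%:R)) *
    (\prod_(l < m) bernstein_basis (n l) (k l) (x 0 l))%:C.

(* When S is a bijection from the cube onto D, pinv (unit_cube R m) S is its
   inverse on D. *)
Definition modified_bernstein (R : realType) (m : nat) (n : 'I_m -> nat)
    (S : 'rV[R]_m -> 'rV[R]_m) (f : 'rV[R]_m -> R[i]) (x : 'rV[R]_m) : R[i] :=
  bernstein n (f \o S) (pinv (unit_cube R m) S x).

Definition koopman (R : realType) (m : nat) (phi : 'rV[R]_m -> 'rV[R]_m)
    (f : 'rV[R]_m -> R[i]) : 'rV[R]_m -> R[i] := f \o phi.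

(* Main.v *)
(** Let [h = f \o phi \o S] on the unit cube; the error at [S y] is
    [bernstein n h y - h y], an average of the increments [h (k / n) - h y].
    The cube being convex, a segment of length [d] splits into at most
    [1 + d / delta] pieces of length at most [delta], so an increment of [h] is
    at most [1 + d / delta <= 5/4 + (d / delta)^2] times its increment at scale
    [delta].  Averaging needs only the variance [x (1 - x) / n <= 1 / (4 n)] of
    each Bernstein basis, which adds [1/4] to [5/4].  For the first bound
    [delta^2] is the sum of the [1 / n_l]; for the second one changes the
    coordinates of [y] into those of [k / n] one at a time and uses
    [delta = 1 / sqrt n_l] in the direction [l]. *)
Require Import Defs.
From HB Require Import structures.
From mathcomp Require Import all_boot all_order all_algebra.
From mathcomp Require Import complex.
From mathcomp Require Import all_classical all_reals all_analysis.
From mathcomp Require Import ring lra.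

Import Order.TTheory GRing.Theory Num.Theory.
Import numFieldNormedType.Exports.

Local Open Scope classical_set_scope.
Local Open Scope ring_scope.

(** * Sums over multi-indices *)

(** Distributivity when the index range varies with [i]: dependent functions are re-indexed by
    [fprod], whose sums become sums over families of tagged values, and there [bigA_distr_big_dep]
    applies. *)
Lemma sum_dffun_prod (R : comPzSemiRingType) (I : finType) (T_ : I -> finType)
    (P : forall i, T_ i -> R) :
  \sum_(k : {dffun forall i, T_ i}) \prod_i P i (k i) =
  \prod_i \sum_(j : T_ i) P i j.
Proof.
rewrite (reindex (@dffun_of_fprod _ T_)) /=; last first.
  exact/onW_bij/dffun_of_fprod_bij.
transitivity (\sum_(t : fprod T_) \prod_(i in I) [ffun j => P i j] (t i)).
  by apply: eq_bigr => t _; apply: eq_bigr => i _; rewrite !ffunE.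
rewrite big_fprod; under [RHS]eq_bigr => i _.
  rewrite (eq_bigr [ffun j => P i j]); last by move=> j _; rewrite ffunE.
  rewrite (big_tag (fun i => [ffun j => P i j])); over.
by rewrite [RHS]bigA_distr_big_dep.
Qed.

(** * Moments of the one-variable Bernstein basis *)

Lemma bernstein_basis_ge0 (R : realType) (n k : nat) (x : R) :
  0 <= x <= 1 -> 0 <= bernstein_basis n k x.
Proof.
case/andP=> x0 x1.
by rewrite /bernstein_basis !mulr_ge0 ?exprn_ge0 ?subr_ge0 ?ler0n.
Qed.

Lemma sum_bernstein_basis (R : realType) (n : nat) (x : R) :
  \sum_(k < n.+1) bernstein_basis n k x = 1.
Proof.
rewrite -[RHS](expr1n _ n) -(subrK x 1) exprDn; apply: eq_bigr => k _.
by rewrite /bernstein_basis -[RHS]mulr_natl mulrAC -mulrA.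
Qed.

(** The identity [k * 'C(n.+1, k) = n.+1 * 'C(n, k.-1)] trades a factor [k] for a drop in degree.
    Taking [F] constant gives the mean, and [F k = k] the second moment. *)
Lemma sum_bernstein_basisS (R : realType) (n : nat) (x : R) (F : nat -> R) :
  \sum_(k < n.+2) bernstein_basis n.+1 k x * (k%:R * F k) =
  n.+1%:R * x * \sum_(k < n.+1) bernstein_basis n k x * F k.+1.
Proof.
rewrite big_ord_recl mul0r mulr0 add0r mulr_sumr; apply: eq_bigr => k _.
rewrite lift0 /bernstein_basis subSS exprS.
have /(congr1 (fun i => i%:R : R)) := mul_bin_diag n.+1 k.
rewrite !natrM /= => e.
transitivity (k.+1%:R * 'C(n.+1, k.+1)%:R * x * x ^+ k * (1 - x) ^+ (n - k) * F k.+1).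
  ring.
by rewrite -e; ring.
Qed.

Lemma bernstein_basis_mean (R : realType) (n : nat) (x : R) :
  \sum_(k < n.+1) bernstein_basis n k x * k%:R = n%:R * x.
Proof.
case: n => [|n]; first by rewrite big_ord1 mulr0 mul0r.
have := @sum_bernstein_basisS R n x (fun=> 1).
under eq_bigr do rewrite mulr1.
move=> ->; under eq_bigr do rewrite mulr1.
by rewrite sum_bernstein_basis mulr1.
Qed.

Lemma bernstein_basis_second_moment (R : realType) (n : nat) (x : R) :
  \sum_(k < n.+2) bernstein_basis n.+1 k x * k%:R ^+ 2 =
  n.+1%:R * x * (n%:R * x + 1).
Proof.
have := @sum_bernstein_basisS R n x (fun k => k%:R).
under eq_bigr do rewrite -expr2.
move=> ->; congr (_ * _).
rewrite -bernstein_basis_mean -[X in _ + X](sum_bernstein_basis _ n x) -big_split.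
by apply: eq_bigr => k _ /=; rewrite -natr1 mulrDr mulr1.
Qed.

Lemma bernstein_basis_variance (R : realType) (n : nat) (x : R) : (0 < n)%N ->
  \sum_(k < n.+1) bernstein_basis n k x * (k%:R / n%:R - x) ^+ 2 =
  x * (1 - x) / n%:R.
Proof.
case: n => // n _; have n0 : (n%:R + 1 : R) != 0 by rewrite natr1 pnatr_eq0.
(* The square is expanded; the three terms carry the moments of order two, one and zero. *)
transitivity (n.+1%:R^-1 ^+ 2 * (n.+1%:R * x * (n%:R * x + 1))
    - 2 * x / n.+1%:R * (n.+1%:R * x) + x ^+ 2 * 1).
  rewrite -bernstein_basis_second_moment -(bernstein_basis_mean _ n.+1).
  rewrite -[X in _ + _ ^+ 2 * X](sum_bernstein_basis _ n.+1 x) !mulr_sumr -sumrB -big_split.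
  apply: eq_bigr => k _ /=; ring.
by rewrite -natr1; field.
Qed.

Lemma bernstein_basis_variance_le (R : realType) (n : nat) (x : R) : (0 < n)%N ->
  \sum_(k < n.+1) bernstein_basis n k x * (k%:R / n%:R - x) ^+ 2 <=
  (4 * n%:R)^-1.
Proof.
move=> n0; rewrite bernstein_basis_variance// invfM ler_pM2r ?invr_gt0 ?ltr0n//.
have := sqr_ge0 (x - 1 / 2); nra.
Qed.

(** * The product weights of the multivariate operator *)

Lemma sum_bernstein_weight (R : realType) (m : nat) (n : 'I_m -> nat)
    (x : 'rV[R]_m) :
  \sum_(k : {dffun forall l : 'I_m, 'I_(n l).+1})
    \prod_(l < m) bernstein_basis (n l) (k l) (x 0 l) = 1.
Proof.
rewrite (sum_dffun_prod _ _ _ (fun l (j : 'I_(n l).+1) => bernstein_basis (n l) j (x 0 l))).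
by rewrite big1 // => l _; exact: sum_bernstein_basis.
Qed.

(** The weights form a product distribution, and this is its marginal: [F] is absorbed into the
    factor [l0], and every other factor sums to 1. *)
Lemma sum_bernstein_weight_coord (R : realType) (m : nat) (n : 'I_m -> nat)
    (x : 'rV[R]_m) (l0 : 'I_m) (F : nat -> R) :
  \sum_(k : {dffun forall l : 'I_m, 'I_(n l).+1})
    (\prod_(l < m) bernstein_basis (n l) (k l) (x 0 l)) * F (k l0) =
  \sum_(j < (n l0).+1) bernstein_basis (n l0) j (x 0 l0) * F j.
Proof.
pose P l (j : 'I_(n l).+1) := bernstein_basis (n l) j (x 0 l) *
  (if l == l0 then F j else 1).
transitivity (\sum_(k : {dffun forall l : 'I_m, 'I_(n l).+1}) \prod_l P l (k l)).
  apply: eq_bigr => k _; rewrite [RHS]big_split /=; congr (_ * _).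
  by rewrite -big_mkcond big_pred1_eq.
rewrite sum_dffun_prod (bigD1 l0) //= [X in _ * X]big1 ?mulr1 => [|l ne].
  by apply: eq_bigr => j _; rewrite /P eqxx.
under eq_bigr do rewrite /P (negbTE ne) mulr1.
exact: sum_bernstein_basis.
Qed.

Lemma bernstein_error_le (R : realType) (m : nat) (n : 'I_m -> nat)
    (g : 'rV[R]_m -> R[i]) (y : 'rV[R]_m) (a : R) (c : 'I_m -> R) :
  (forall l, (0 < n l)%N) -> unit_cube R m y -> (forall l, 0 <= c l) ->
  (forall k : {dffun forall l : 'I_m, 'I_(n l).+1},
    Normc.normc (g (\row_l ((k l)%:R / (n l)%:R)) - g y) <=
    a + \sum_l c l * ((k l)%:R / (n l)%:R - y 0 l) ^+ 2) ->
  Normc.normc (bernstein n g y - g y) <= a + \sum_l c l / (4 * (n l)%:R).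
Proof.
move=> n0 y01 c0 hg.
pose W (k : {dffun forall l : 'I_m, 'I_(n l).+1}) :=
  \prod_(l < m) bernstein_basis (n l) (k l) (y 0 l).
have W0 k : 0 <= W k by apply: prodr_ge0 => l _; exact: bernstein_basis_ge0.
(* As the weights sum to 1, [g y] is itself a weighted average and can be moved under the sum. *)
have -> : bernstein n g y - g y =
    \sum_(k : {dffun forall l : 'I_m, 'I_(n l).+1}) (g (\row_l ((k l)%:R / (n l)%:R)) - g y) * (W k)%:C%C.
  under [RHS]eq_bigr do rewrite mulrBl.
  rewrite sumrB -mulr_sumr; congr (_ - _).
  by rewrite -rmorph_sum sum_bernstein_weight mulr1.
(* [Rcomplex R] is the complex numbers normed by the [R]-valued modulus, so the triangle inequality
   is one between reals. *)
apply: le_trans (@ler_norm_sum R (Rcomplex R) _ _ _ _) _.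
apply: (@le_trans _ _ (\sum_(k : {dffun forall l : 'I_m, 'I_(n l).+1}) W k *
   (a + \sum_l c l * ((k l)%:R / (n l)%:R - y 0 l) ^+ 2))).
  apply: ler_sum => k _.
  rewrite -[X in X <= _]/(Normc.normc _) Normc.normcM.
  rewrite {2}/Normc.normc /= expr0n addr0 sqrtr_sqr ger0_norm // mulrC.
  exact: ler_wpM2l.
under eq_bigr do rewrite mulrDr.
rewrite big_split /= -mulr_suml sum_bernstein_weight mul1r lerD2l.
under eq_bigr do rewrite mulr_sumr.
rewrite exchange_big; apply: ler_sum => l _ /=.
under eq_bigr do rewrite mulrCA.
rewrite -mulr_sumr ler_wpM2l //.
rewrite (sum_bernstein_weight_coord _ _ _ _ _ (fun j => (j%:R / (n l)%:R - y 0 l) ^+ 2)).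
exact: bernstein_basis_variance_le.
Qed.

(** * Increments along a segment *)

(** In the applications [gam] is a function on the cube restricted to a segment of length [d],
    parametrized by the unit interval. *)
Lemma dist_chain_le (R : realType) (V : normedZmodType R) (gam : R -> V)
    (d delta w : R) :
  0 < delta -> 0 <= d ->
  (forall s t, 0 <= s <= 1 -> 0 <= t <= 1 -> d * `|s - t| <= delta ->
    `|gam s - gam t| <= w) ->
  `|gam 1 - gam 0| <= (5 / 4 + d ^+ 2 / delta ^+ 2) * w.
Proof.
move=> de0 d0 hgam.
have w0 : 0 <= w.
  apply: le_trans (normr_ge0 (gam 0 - gam 0)) (hgam 0 0 _ _ _);
    by rewrite ?lexx ?ler01 // subrr normr0 mulr0 ltW.
(* Since [r < q <= 1 + r], cutting into [q] equal pieces gives pieces of length at most [delta]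
   without using more than [1 + r] of them. *)
pose r := d / delta; pose q : nat := (Num.truncn r).+1.
have r0 : 0 <= r by rewrite divr_ge0 // ltW.
have /andP[rl ru] := truncn_itv r0.
have q0 : 0 < q%:R :> R by rewrite ltr0n.
pose u k := gam (k%:R / q%:R).
have -> : gam 1 - gam 0 = u q - u 0%N by rewrite /u mul0r divff // gt_eqF.
rewrite -(telescope_sumr u (leq0n q)).
apply: le_trans (ler_norm_sum _ _ _) _.
apply: (@le_trans _ _ (\sum_(0 <= k < q) w)).
  rewrite !big_mkord; apply: ler_sum => k _; apply: hgam.
  - by rewrite divr_ge0 ?ler0n //= ler_pdivrMr // mul1r ler_nat ltn_ord.
  - by rewrite divr_ge0 ?ler0n //= ler_pdivrMr // mul1r ler_nat ltnW.
  rewrite -mulrBl -natrB // subSnn mul1r ger0_norm ?invr_ge0 ?ler0n //.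
  by rewrite ler_pdivrMr // mulrC -ler_pdivrMr // ltW.
rewrite sumr_const_nat subn0 -[w *+ _]mulr_natl ler_wpM2r // -expr_div_n -/r.
apply: (@le_trans _ _ (1 + r)); first by rewrite /q -natr1 addrC lerD2l.
(* [(r - 1/2)^2 >= 0] makes the second moment suffice, without Cauchy-Schwarz. *)
have := sqr_ge0 (r - 1 / 2); nra.
Qed.

(** * The cube, the Euclidean norm and the modulus of continuity *)

Lemma unit_cube_segment (R : realType) (m : nat) (u v : 'rV[R]_m) (s : R) :
  unit_cube R m u -> unit_cube R m v -> 0 <= s <= 1 ->
  unit_cube R m (v + s *: (u - v)).
Proof.
move=> u01 v01 /andP[s0 s1] l; rewrite !mxE.
have /andP[? ?] := u01 l; have /andP[? ?] := v01 l.
by apply/andP; split; nra.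
Qed.

Lemma bernstein_node_unit_cube (R : realType) (m : nat) (n : 'I_m -> nat)
    (k : {dffun forall l : 'I_m, 'I_(n l).+1}) :
  (forall l, (0 < n l)%N) ->
  unit_cube R m (\row_l ((k l)%:R / (n l)%:R)).
Proof.
move=> n0 l; rewrite mxE divr_ge0 ?ler0n //= ler_pdivrMr ?ltr0n //.
by rewrite mul1r ler_nat -ltnS.
Qed.

Lemma euclid_normZ (R : realType) (m : nat) (s : R) (x : 'rV[R]_m) :
  euclid_norm (s *: x) = `|s| * euclid_norm x.
Proof.
rewrite /euclid_norm -sqrtr_sqr -sqrtrM ?sqr_ge0 //; congr Num.sqrt.
by rewrite mulr_sumr; apply: eq_bigr => l _; rewrite mxE exprMn.
Qed.

Lemma sqr_euclid_norm (R : realType) (m : nat) (x : 'rV[R]_m) :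
  euclid_norm x ^+ 2 = \sum_l x 0 l ^+ 2.
Proof. by rewrite sqr_sqrtr // sumr_ge0 // => l _; exact: sqr_ge0. Qed.

Lemma le_modulus (R : realType) (m : nat) (D : set 'rV[R]_m)
    (f : 'rV[R]_m -> R[i]) (delta w : R) (x y : 'rV[R]_m) :
  modulus_of_continuity D f delta = w%:E -> D x -> D y ->
  euclid_norm (x - y) <= delta -> Normc.normc (f x - f y) <= w.
Proof.
move=> Ew Dx Dy xy; rewrite -lee_fin -Ew; apply: ereal_sup_ubound.
by exists x, y.
Qed.

(** The pair [x, x] is admissible, so the supremum is not that of an empty set; this excludes the
    value [-oo]. *)
Lemma modulus_ge0 (R : realType) (m : nat) (D : set 'rV[R]_m)
    (f : 'rV[R]_m -> R[i]) (delta : R) (x : 'rV[R]_m) :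
  D x -> 0 <= delta -> (0 <= modulus_of_continuity D f delta)%E.
Proof.
move=> Dx de0; apply: ereal_sup_ubound; exists x, x; split=> //.
  by rewrite subrr -(scale0r 0) euclid_normZ normr0 mul0r.
by rewrite subrr Normc.normc0.
Qed.

(** * The two error bounds on the cube *)

Lemma bernstein_error_total (R : realType) (m : nat) (n : 'I_m -> nat)
    (h : 'rV[R]_m -> R[i]) (y : 'rV[R]_m) (w : R) :
  (0 < m)%N -> (forall l, (0 < n l)%N) -> unit_cube R m y ->
  (forall u v, unit_cube R m u -> unit_cube R m v ->
    euclid_norm (u - v) <= Num.sqrt (\sum_(l < m) (n l)%:R^-1) ->
    Normc.normc (h u - h v) <= w) ->
  Normc.normc (bernstein n h y - h y) <= 3 / 2 * w.
Proof.
move=> m0 n0 y01 hh.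
set delta := Num.sqrt _ in hh.
have sum0 : 0 < \sum_(l < m) (n l)%:R^-1 :> R.
  rewrite (bigD1 (Ordinal m0)) //= ltr_pwDl ?invr_gt0 ?ltr0n //.
  by rewrite sumr_ge0 // => l _; rewrite invr_ge0 ler0n.
have de0 : 0 < delta by rewrite sqrtr_gt0.
have de2 : delta ^+ 2 = \sum_(l < m) (n l)%:R^-1 by rewrite sqr_sqrtr // ltW.
have w0 : 0 <= w.
  apply: le_trans (hh y y y01 y01 _); rewrite subrr ?Normc.normc0 //.
  by rewrite -(scale0r 0) euclid_normZ normr0 mul0r ltW.
(* With coefficients [w / delta ^+ 2], the variance bounds [1 / (4 n_l)] add up to [w / 4], whence
   3/2 = 5/4 + 1/4. *)
have -> : 3 / 2 * w = 5 / 4 * w + \sum_l (w / delta ^+ 2) / (4 * (n l)%:R).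
  under eq_bigr do rewrite (invfM 4) mulrA.
  by rewrite -mulr_sumr -de2; field; rewrite gt_eqF.
apply: (@bernstein_error_le R m n h y _ (fun=> w / delta ^+ 2)) => // [l|k].
  by rewrite divr_ge0 ?sqr_ge0.
set u := \row_l _; have u01 : unit_cube R m u by exact: bernstein_node_unit_cube.
have -> : 5 / 4 * w + \sum_l w / delta ^+ 2 * ((k l)%:R / (n l)%:R - y 0 l) ^+ 2
    = (5 / 4 + euclid_norm (u - y) ^+ 2 / delta ^+ 2) * w.
  rewrite sqr_euclid_norm -mulr_sumr [RHS]mulrDl; congr (_ + _).
  rewrite mulrAC -mulrA mulrC; congr (_ * _ * _).
  by apply: eq_bigr => l _; rewrite !mxE.
have := @dist_chain_le R (Rcomplex R) (fun s => h (y + s *: (u - y)))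
  (euclid_norm (u - y)) delta w de0 (sqrtr_ge0 _).
rewrite scale1r scale0r addr0 (addrC y) subrK; apply=> s t s01 t01 st.
apply: hh; try exact: unit_cube_segment.
by rewrite opprD addrACA subrr add0r -scalerBl euclid_normZ mulrC.
Qed.

Lemma bernstein_error_partial (R : realType) (m : nat) (n : 'I_m -> nat)
    (h : 'rV[R]_m -> R[i]) (y : 'rV[R]_m) (w : 'I_m -> R) :
  (forall l, (0 < n l)%N) -> unit_cube R m y ->
  (forall l u v, unit_cube R m u -> unit_cube R m v ->
    (forall j, j != l -> u 0 j = v 0 j) ->
    `|u 0 l - v 0 l| <= (Num.sqrt (n l)%:R)^-1 ->
    Normc.normc (h u - h v) <= w l) ->
  Normc.normc (bernstein n h y - h y) <= 3 / 2 * \sum_l w l.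
Proof.
move=> n0 y01 hh.
have nR0 l : 0 < (n l)%:R :> R by rewrite ltr0n.
have w0 l : 0 <= w l.
  apply: le_trans (hh l y y y01 y01 _ _); rewrite // subrr ?Normc.normc0 //.
  by rewrite normr0 invr_ge0 sqrtr_ge0.
(* The scale in direction [l] is [1 / sqrt n_l], so the coefficient is [w l * n l] and each variance
   bound contributes [w l / 4]. *)
have -> : 3 / 2 * \sum_l w l =
    \sum_l 5 / 4 * w l + \sum_l (w l * (n l)%:R) / (4 * (n l)%:R).
  rewrite mulr_sumr -big_split; apply: eq_bigr => l _ /=.
  by field; rewrite gt_eqF.
apply: bernstein_error_le => // [l|k]; first by rewrite mulr_ge0 ?ler0n.
set u := \row_l _; have u01 : unit_cube R m u by exact: bernstein_node_unit_cube.
(* A staircase from [y = z 0] to [u = z m]: the first [i] coordinates come from [u], the others from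
   [y]. *)
pose z i : 'rV[R]_m := \row_j (if (j < i)%N then u 0 j else y 0 j).
have z01 i : unit_cube R m (z i) by move=> j; rewrite mxE; case: ifP.
have -> : h u - h y = h (z m) - h (z 0%N).
  by congr (h _ - h _); apply/rowP => j; rewrite [RHS]mxE ?ltn_ord.
rewrite -(telescope_sumr (h \o z) (leq0n m)) big_mkord.
apply: le_trans (@ler_norm_sum R (Rcomplex R) _ _ _ _) _.
rewrite -big_split; apply: ler_sum => l _ /=.
have -> : 5 / 4 * w l + w l * (n l)%:R * ((k l)%:R / (n l)%:R - y 0 l) ^+ 2 =
    (5 / 4 + `|u 0 l - y 0 l| ^+ 2 / (Num.sqrt (n l)%:R)^-1 ^+ 2) * w l.
  rewrite real_normK ?num_real // exprVn invrK sqr_sqrtr ?ler0n // mxE.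
  ring.
have s0 : 0 < (Num.sqrt (n l)%:R)^-1 :> R by rewrite invr_gt0 sqrtr_gt0.
(* The edge from [z l] to [z l.+1] is parallel to axis [l] and has length [|u_l - y_l|]. *)
have := @dist_chain_le R (Rcomplex R)
  (fun s => h (z l + s *: (z l.+1 - z l))) `|u 0 l - y 0 l| _ (w l) s0 (normr_ge0 _).
rewrite scale1r scale0r addr0 (addrC (z l)) subrK; apply=> s t s01 t01 st.
apply: hh; try exact: unit_cube_segment.
  move=> j jl; rewrite !mxE ltnS (leq_eqVlt j).
  by rewrite -[_ == _ :> nat]/(j == l) (negbTE jl) /= subrr !mulr0.
move: st; rewrite !mxE ltnn leqnn; apply: le_trans.
by rewrite opprD addrACA subrr add0r -mulrBl normrM mulrC.
Qed.

(** * Transfer from the cube to [D] *)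

Theorem corollary5p1 (R : realType) (m : nat) (hm : (1 <= m)%N)
    (D : set 'rV[R]_m) (hD : compact D)
    (phi : 'rV[R]_m -> 'rV[R]_m) (hphi : set_fun D D phi)
    (Lphi : R) (hLphi : lipschitz_constant D phi Lphi)
    (S : 'rV[R]_m -> 'rV[R]_m) (hS : set_bij (unit_cube R m) D S)
    (LS : R) (hLS : lipschitz_constant (unit_cube R m) S LS)
    (LSl : 'I_m -> R)
    (hLSl : forall l, partial_lipschitz_constant S l (LSl l))
    (n : 'I_m -> nat) (hn : forall l, (0 < n l)%N)
    (f : 'rV[R]_m -> R[i]) (hf : continuous_on D f) :
  (sup_norm D (modified_bernstein n S (koopman phi f) \- koopman phi f)%R
     <= (3 / 2)%R%:E *
        modulus_of_continuity D f
          (Lphi * LS * Num.sqrt (\sum_(l < m) (n l)%:R^-1))%R)%E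
  /\
  (sup_norm D (modified_bernstein n S (koopman phi f) \- koopman phi f)%R
     <= (3 / 2)%R%:E *
        \sum_(l < m)
          modulus_of_continuity D f
            (Lphi * LSl l / Num.sqrt (n l)%:R)%R)%E.
Proof.
case: hLphi => Lphi0 hLphi; case: hLS => LS0 hLS.
pose h := koopman phi f \o S.
have Spinv x : D x -> exists2 y, unit_cube R m y &
    (modified_bernstein n S (koopman phi f) \- koopman phi f) x =
    bernstein n h y - h y.
  move=> Dx; have [SD _ Ssurj] := hS.
  exists (pinv (unit_cube R m) S x).
    by have [+ _ _] := bijpinv_bij (fun=> point) hS; apply.
  by rewrite /= {2}/h /= (surjpK _ Ssurj) // inE.
have SD u : unit_cube R m u -> D (S u) by have [+ _ _] := hS; apply.
have pD x : D x -> D (phi x) by exact: hphi.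
have c0 : (0 : R) < 3 / 2 by lra.
split; apply: ge_ereal_sup => _ [x Dx <-]; have [y y01 ->] := Spinv x Dx.
(* The modulus is an extended real: a finite value feeds the bound on the cube, [+oo] makes the
   claim trivial, and [-oo] contradicts nonnegativity. *)
- case Ew: (modulus_of_continuity _ _ _) => [w| |].
  + rewrite -EFinM lee_fin; apply: bernstein_error_total => // u v u01 v01 uv.
    (* Composing the two Lipschitz bounds, points of the cube at distance at most [delta] have
       images under [phi \o S] at distance at most [Lphi * LS * delta]. *)
    apply: (le_modulus _ _ _ _ _ _ _ _ Ew); try by apply/pD/SD.
    apply: le_trans (hLphi _ _ (SD _ u01) (SD _ v01)) _.
    rewrite -mulrA ler_wpM2l //; apply: le_trans (hLS _ _ u01 v01) _.
    exact: ler_wpM2l.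
  + by rewrite gt0_muley ?lte_fin // leey.
  + suff : (0 <= -oo :> \bar R)%E by [].
    rewrite -Ew; apply: (modulus_ge0 _ _ _ _ _ _ Dx).
    by rewrite !mulr_ge0 ?sqrtr_ge0.
- set W := fun l : 'I_m => modulus_of_continuity D f (Lphi * LSl l / Num.sqrt (n l)%:R).
  have W0 l : (0 <= W l)%E.
    have [? _] := hLSl l.
    by apply: (modulus_ge0 _ _ _ _ _ _ Dx); rewrite !mulr_ge0 // invr_ge0 sqrtr_ge0.
  (* One infinite term makes the whole sum [+oo], the remaining terms being nonnegative; otherwise
     all terms are real and the sum is computed in [R]. *)
  have [/existsP[l /eqP Wl]|/existsPn Wfin] := boolP [exists l, W l == +oo%E].
    have s0 : (0 <= \sum_(i < m | i != l) W i)%E by apply: sume_ge0.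
    rewrite (bigD1 l) //= -/(W l) Wl addye ?gt0_muley ?lte_fin ?leey //.
    by rewrite -ltNye (lt_le_trans ltNy0 s0).
  have EW l : W l = (fine (W l))%:E.
    by rewrite fineK // ge0_fin_numE // ltey.
  rewrite (eq_bigr (fun l => (fine (W l))%:E)) => [|l _]; last exact: EW.
  rewrite sumEFin -EFinM lee_fin; apply: bernstein_error_partial => //.
  move=> l u v u01 v01 uv duv; have [L0 hL] := hLSl l.
  apply: (le_modulus _ _ _ _ _ _ _ _ (EW l)); try by apply/pD/SD.
  apply: le_trans (hLphi _ _ (SD _ u01) (SD _ v01)) _.
  rewrite -mulrA ler_wpM2l //; apply: le_trans (hL _ _ u01 v01 uv) _.
  exact: ler_wpM2l.
Qed.
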